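(* If $f$ is an $S^1$-almost automorphic function, then the associated distribution $T_f$ is almost automorphic, i.e. $T_f\in\mathcal{B}'_{aa}$.
   Context: All functions and distributions are complex-valued and defined on $\mathbb{R}$; $\mathcal{D}$ is the space of smooth compactly supported functions and $\mathcal{D}'$ the space of distributions. For $f\in L^1_{loc}$, $\langle T_f,\varphi\rangle=\int_{\mathbb{R}}f(t)\varphi(t)\,dt$ for $\varphi\in\mathcal{D}$. A function $f\in L^1_{loc}$ is $S^1$-almost automorphic (Stepanov almost automorphic) if for every sequence $(s_m)_{m\in\mathbb{N}}\subset\mathbb{R}$ there are a subsequence $(s_{m_k})_{k\in\mathbb{N}}$ and a function $g\in L^1_{loc}$ such that for every $x\in\mathbb{R}$, $\lim_{k\to+\infty}\int_0^1|f(x+s_{m_k}+t)-g(x+t)|\,dt=0$ and $\lim_{k\to+\infty}\int_0^1|g(x-s_{m_k}+t)-f(x+t)|\,dt=0$. A continuous function $f:\mathbb{R}\to\mathbb{C}$ is almost automorphic if for every real sequence $(s_m)_{m\in\mathbb{N}}$ there is a subsequence $(s_{m_k})_k$ such that $g(x):=\lim_{k\to+\infty}f(x+s_{m_k})$ is well-defined for every $x\in\mathbb{R}$ and $\lim_{k\to+\infty}g(x-s_{m_k})=f(x)$ for every $x\in\mathbb{R}$. $\mathcal{C}_{aa}$ denotes the space of almost automorphic functions. $\mathcal{D}_{L^1}=\{\varphi\in\mathcal{C}^\infty:\ \varphi^{(i)}\in L^1\ \forall i\in\mathbb{Z}_+\}$ is a Fréchet space for the norms $|\varphi|_{m,1}=\sum_{i=0}^m\|\varphi^{(i)}\|_{L^1}$,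 $m\in\mathbb{Z}_+$, and $\mathcal{D}$ is dense in it. $\mathcal{D}'_{L^\infty}$ is the topological dual of $\mathcal{D}_{L^1}$, regarded as a subspace of $\mathcal{D}'$; its elements are called bounded distributions. For $\varphi\in\mathcal{D}$, $(T\ast\varphi)(x)=\langle T,\varphi(x-\cdot)\rangle$. A distribution $T\in\mathcal{D}'_{L^\infty}$ is called almost automorphic if it satisfies either of the following equivalent conditions: (i) $T\ast\varphi\in\mathcal{C}_{aa}$ for all $\varphi\in\mathcal{D}$; (ii) $T=\sum_{j=0}^kf_j^{(j)}$ for some $k\in\mathbb{Z}_+$ and $f_0,\dots,f_k\in\mathcal{C}_{aa}$ (distributional derivatives). $\mathcal{B}'_{aa}$ is the space of almost automorphic distributions. *)

(* Defs.v *)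
From HB Require Import structures.
From mathcomp Require Import all_boot all_order all_algebra.
From mathcomp Require Import complex.
From mathcomp Require Import all_classical all_reals all_analysis.

Set Implicit Arguments.
Unset Strict Implicit.
Unset Printing Implicit Defensive.

Import Order.TTheory GRing.Theory Num.Theory.
Import numFieldNormedType.Exports.

Local Open Scope ring_scope.
Local Open Scope classical_set_scope.

(** The complex numbers are [Rcomplex R], the copy of [R[i]] whose norm
    [`|z|] = sqrt (Re z ^+ 2 + Im z ^+ 2) takes its values in [R].  The field
    operations are those of [R[i]].  The instances below add the topology of
    the modulus and make it a normed [R]-module, so that the library's
    continuity, limits and derivatives apply to functions [R -> Rcomplex R]. *)

Lemma Rcomplex_normrZ (R : rcfType) (a : R) (z : Rcomplex R) :
  `|a *: z| = `|a| * `|z|.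
Proof.
case: z => x y; rewrite /Num.norm/=.
by rewrite !exprMn -mulrDr sqrtrM ?sqr_ge0// sqrtr_sqr.
Qed.

HB.instance Definition _ (R : realType) := isPointed.Build (Rcomplex R) 0.
HB.instance Definition _ (R : realType) :=
  PseudoMetric.copy (Rcomplex R) (pseudoMetric_normed (Rcomplex R)).
HB.instance Definition _ (R : realType) :=
  NormedZmod_PseudoMetric_eq.Build R (Rcomplex R) erefl.
HB.instance Definition _ (R : realType) :=
  PseudoMetricNormedZmod_Lmodule_isNormedModule.Build R (Rcomplex R)
    (@Rcomplex_normrZ R).

Section almost_automorphy.
Context {R : realType}.
Local Notation C := (Rcomplex R).
Local Notation mu := (@lebesgue_measure R).
Implicit Types (f g phi psi : R -> C) (T U : (R -> C) -> C).

Definition L1 f : Prop :=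
  mu.-integrable setT (EFin \o (fun x => complex.Re (f x))) /\
  mu.-integrable setT (EFin \o (fun x => complex.Im (f x))).

Definition L1loc f : Prop :=
  locally_integrable setT (fun x => complex.Re (f x)) /\
  locally_integrable setT (fun x => complex.Im (f x)).

Definition cintegral f : C :=
  Complex (\int[mu]_x complex.Re (f x)) (\int[mu]_x complex.Im (f x)).

Definition S1_almost_automorphic f : Prop :=
  L1loc f /\
  forall s : nat -> R, exists sigma : nat -> nat, increasing_seq sigma /\
  exists g, L1loc g /\ forall x : R,
    (\int[mu]_(t in `[0%R, 1%R])
       (`|f (x + s (sigma k) + t) - g (x + t)|%R)%:E)%E
         @[k --> \oo] --> 0%E /\
    (\int[mu]_(t in `[0%R, 1%R])
       (`|g (x - s (sigma k) + t) - f (x + t)|%R)%:E)%E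
         @[k --> \oo] --> 0%E.

Definition almost_automorphic f : Prop :=
  continuous f /\
  forall s : nat -> R, exists sigma : nat -> nat, increasing_seq sigma /\
  exists g, forall x : R,
    f (x + s (sigma k)) @[k --> \oo] --> g x /\
    g (x - s (sigma k)) @[k --> \oo] --> f x.

Definition smooth phi : Prop :=
  forall (i : nat) (x : R), derivable (derive1n i phi) x 1.

Definition supp phi : set R := closure [set x | phi x != 0].

Definition test_function phi : Prop := smooth phi /\ compact (supp phi).

(** Functionals are total on [R -> C]; only their values on the relevant space
    [E] of functions matter. *)
Definition linear_on (E : (R -> C) -> Prop) T : Prop :=
  forall (a : C) phi psi, E phi -> E psi ->
    T (fun x => a * phi x + psi x) = a * T phi + T psi.

(** For a test function [phi] the set below is bounded, hence [sup] is the supremum. *)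
Definition sup_norm phi : R := sup (range (fun x => `|phi x|)).

(** [T] is in D': on each D_K, the test functions supported in [K], it is bounded by finitely many of the
    seminorms defining the topology of D_K. *)
Definition is_distribution T : Prop :=
  linear_on test_function T /\
  forall K : set R, compact K -> exists (c : R) (m : nat),
    forall phi, test_function phi -> supp phi `<=` K ->
      `|T phi| <= c * \sum_(i < m.+1) sup_norm (derive1n i phi).

(** The space D_{L^1} and its norms |.|_{m,1}, which are finite on it. *)
Definition DL1 phi : Prop := smooth phi /\ forall i : nat, L1 (derive1n i phi).

Definition DL1_norm (m : nat) phi : \bar R :=
  (\sum_(i < m.+1) \int[mu]_x (`|derive1n i phi x|%R)%:E)%E.

(** Continuity for the locally convex topology defined by the norms
    [DL1_norm m]; these increase with [m], so their balls form a basis of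
    neighbourhoods. *)
Definition DL1_continuous U : Prop :=
  forall phi, DL1 phi -> forall e : R, 0 < e ->
  exists (m : nat) (d : R), 0 < d /\
    forall psi, DL1 psi ->
      (DL1_norm m (psi \- phi)%R < d%:E)%E -> `|U psi - U phi| < e.

(** The space D'_{L^oo}, the dual of D_{L^1}, seen as a subspace of D'. *)
Definition bounded_distribution T : Prop :=
  is_distribution T /\
  exists U, [/\ linear_on DL1 U, DL1_continuous U &
    forall phi, test_function phi -> T phi = U phi].

Definition convolution T phi : R -> C := fun x => T (fun y => phi (x - y)).

(** The space B'_aa, through almost automorphy of all regularisations rather
    than the equivalent representation as a finite sum of derivatives of almost
    automorphic functions. *)
Definition almost_automorphic_distribution T : Prop :=
  bounded_distribution T /\
  forall phi, test_function phi -> almost_automorphic (convolution T phi).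

Definition distribution_of f : (R -> C) -> C :=
  fun phi => cintegral (fun t => f t * phi t).

End almost_automorphy.

(* Main.v *)
Require Import Defs.
From HB Require Import structures.
From mathcomp Require Import all_boot all_order all_algebra.
From mathcomp Require Import complex.
From mathcomp Require Import all_classical all_reals all_analysis.
From mathcomp Require Import measurable_realfun lra.

(** A Stepanov almost automorphic [f] has uniformly bounded mass [M] on unit
    windows.  Since [|phi y|] is at most twice the integral of
    [|phi| + |phi'|] over [[y, y + 1]], Tonelli's theorem bounds the integral of
    [|f phi|] by [2 M |phi|_{1,1}]: the formula for [T_f] makes sense on
    [D_{L^1}] and is continuous there.  Moreover [(T_f * phi)(x + s)] is the
    integral of [f(y + s) phi(x - y)], and [phi] has compact support, so
    convergence of translates of [f] on finitely many unit windows gives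
    convergence of the translates of [T_f * phi] to those of [T_g * phi]. *)

Set Implicit Arguments.
Unset Strict Implicit.
Unset Printing Implicit Defensive.

Import Order.TTheory GRing.Theory Num.Theory.
Import numFieldNormedType.Exports.

Local Open Scope ring_scope.
Local Open Scope classical_set_scope.

(** * Translation invariance of Lebesgue measure and of the integral *)

Section translation.
Context {R : realType}.
Local Notation mu := (@lebesgue_measure R).
Local Open Scope ereal_scope.

Lemma measurable_shift (a : R) :
  measurable_fun [set: R] (fun x : R => x + a)%R.
Proof. exact: measurable_funD. Qed.

(** Lebesgue measure is determined by its values on the intervals []u, v]], and translation
    preserves their lengths. *)
Lemma lebesgue_measure_shift (a : R) (A : set R) : measurable A ->
  pushforward mu ((fun x => x + a)%R : _ -> measurableTypeR R) A = mu A.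
Proof.
move=> mA; apply/esym/lebesgue_measure_unique => //=.
  exact: measurable_shift.
move=> mshift _ [[u v]] _ <-.
rewrite /pushforward (_ : _ @^-1` _ = `](u - a)%R, (v - a)%R]%classic).
  rewrite !lebesgue_measure_itv/= !lte_fin ltrD2r.
  by case: ifPn => // _; rewrite -!EFinB; congr EFin; lra.
by apply/seteqP; split => x /=; rewrite !in_itv/= ltrBlDr lerBrDr.
Qed.

Lemma ge0_integral_shift (a : R) (f : R -> \bar R) :
  measurable_fun [set: R] f -> (forall x, 0 <= f x) ->
  \int[mu]_x f (x + a)%R = \int[mu]_x f x.
Proof.
move=> mf f0.
transitivity (\int[pushforward mu
    ((fun x => x + a)%R : _ -> measurableTypeR R)]_x f x).
  by rewrite ge0_integral_pushforward//=; exact: measurable_shift.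
apply: eq_measure_integral => /=; first exact: measurable_shift.
by move=> ? A mA _; exact: lebesgue_measure_shift.
Qed.

(** Positive and negative parts are translated separately, so the extended integrals agree before
    [fine] is taken, even when they are infinite. *)
Lemma Rintegral_shift (a : R) (f : R -> R) : measurable_fun [set: R] f ->
  (\int[mu]_x f (x + a) = \int[mu]_x f x)%R.
Proof.
move=> mf; have mEf : measurable_fun setT (EFin \o f) by exact/measurable_EFinP.
rewrite /Rintegral; congr fine; rewrite integralE [RHS]integralE.
congr (_ - _).
- rewrite -(ge0_integral_shift a (measurable_funepos mEf))//.
  by apply: eq_integral => x _; rewrite !funeposE.
- rewrite -(ge0_integral_shift a (measurable_funeneg mEf))//.
  by apply: eq_integral => x _; rewrite !funenegE.
Qed.

End translation.

(** * Measurability, integrability and integral estimates for complex-valued functions *)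

Section complex_valued.
Context {R : realType}.
Local Notation C := (Rcomplex R).
Local Notation mu := (@lebesgue_measure R).
Implicit Types (F G : R -> C) (z w : C).

Lemma Rcomplex_normM z w : `|z * w : C| = `|z| * `|w|.
Proof. exact: ComplexField.Normc.normcM. Qed.

Lemma normr_Re z : `|complex.Re z| <= `|z|.
Proof.
case: z => a b; rewrite {2}/Num.norm/= -sqrtr_sqr.
by rewrite ler_wsqrtr// lerDl sqr_ge0.
Qed.

Lemma normr_Im z : `|complex.Im z| <= `|z|.
Proof.
case: z => a b; rewrite {2}/Num.norm/= -sqrtr_sqr.
by rewrite ler_wsqrtr// lerDr sqr_ge0.
Qed.

Lemma Rcomplex_norm_le z : `|z| <= `|complex.Re z| + `|complex.Im z|.
Proof.
case: z => a b; rewrite {1}/Num.norm/=.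
rewrite -[leRHS]ger0_norm ?addr_ge0// -sqrtr_sqr ler_wsqrtr//.
rewrite sqrrD !real_normK ?num_real// lerD2r lerDl.
by rewrite mulrn_wge0// mulr_ge0.
Qed.

(** Measurability is taken componentwise, to match [L1], [L1loc] and [cintegral], which treat real
    and imaginary parts separately. *)
Definition cmeasurable F :=
  measurable_fun setT (fun x => complex.Re (F x)) /\
  measurable_fun setT (fun x => complex.Im (F x)).

Lemma cmeasurable_norm F : cmeasurable F ->
  measurable_fun setT (fun x => `|F x|).
Proof.
move=> [mr mi].
rewrite (_ : (fun _ => _) = (fun x =>
   Num.sqrt (complex.Re (F x) ^+ 2 + complex.Im (F x) ^+ 2))); last first.
  by apply/funext => x; case: (F x).
apply: (measurableT_comp (continuous_measurable_fun (@sqrt_continuous R))) => //.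
apply: measurable_funD; exact: measurable_funX.
Qed.

Lemma Re_mul z w : complex.Re (z * w) =
  complex.Re z * complex.Re w - complex.Im z * complex.Im w.
Proof. by case: z; case: w. Qed.

Lemma Im_mul z w : complex.Im (z * w) =
  complex.Re z * complex.Im w + complex.Im z * complex.Re w.
Proof. by case: z; case: w. Qed.

Lemma cmeasurableM F G : cmeasurable F -> cmeasurable G ->
  cmeasurable (fun x => F x * G x).
Proof.
move=> [mr mi] [nr ni]; split.
- under eq_fun do rewrite Re_mul.
  by apply: measurable_funB; exact: measurable_funM.
- under eq_fun do rewrite Im_mul.
  by apply: measurable_funD; exact: measurable_funM.
Qed.

Lemma cmeasurableB F G : cmeasurable F -> cmeasurable G ->
  cmeasurable (fun x => F x - G x).
Proof.
move=> [mr mi] [nr ni]; split.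
- by under eq_fun do rewrite raddfB/=; exact: measurable_funB.
- by under eq_fun do rewrite raddfB/=; exact: measurable_funB.
Qed.

Lemma cmeasurable_shift F a : cmeasurable F -> cmeasurable (fun x => F (x + a)).
Proof.
move=> [mr mi]; split.
- exact: (measurableT_comp mr (measurable_shift a)).
- exact: (measurableT_comp mi (measurable_shift a)).
Qed.

Lemma cmeasurable_shiftl F a : cmeasurable F -> cmeasurable (fun x => F (a + x)).
Proof.
move=> /(cmeasurable_shift a).
by rewrite (_ : (fun x => F (x + a)) = (fun x => F (a + x)))//;
  apply/funext => x; rewrite addrC.
Qed.

Lemma Re_continuous : continuous (@complex.Re R : C -> R).
Proof.
move=> z; apply/(@cvgrPdist_le _ _ _ (nbhs z) (nbhs_filter z)) => /= e e0.
near=> w; rewrite -raddfB/=; apply: le_trans (normr_Re _) _; near: w.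
exact: (@cvgr_dist_le _ _ _ _ _ id z (@cvg_id _ (nbhs z))).
Unshelve. all: by end_near. Qed.

Lemma Im_continuous : continuous (@complex.Im R : C -> R).
Proof.
move=> z; apply/(@cvgrPdist_le _ _ _ (nbhs z) (nbhs_filter z)) => /= e e0.
near=> w; rewrite -raddfB/=; apply: le_trans (normr_Im _) _; near: w.
exact: (@cvgr_dist_le _ _ _ _ _ id z (@cvg_id _ (nbhs z))).
Unshelve. all: by end_near. Qed.

Lemma continuous_cmeasurable F : continuous F -> cmeasurable F.
Proof.
move=> cF; split; apply: continuous_measurable_fun => x.
- exact: (continuous_comp (cF x) (@Re_continuous _)).
- exact: (continuous_comp (cF x) (@Im_continuous _)).
Qed.

Lemma L1_cmeasurable F : L1 F -> cmeasurable F.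
Proof.
by move=> [/measurable_int mr /measurable_int mi]; split; exact/measurable_EFinP.
Qed.

Lemma L1loc_cmeasurable F : L1loc F -> cmeasurable F.
Proof. by move=> [[mr _ _] [mi _ _]]. Qed.

Local Open Scope ereal_scope.

Lemma L1P F : cmeasurable F -> \int[mu]_x (`|F x|%R)%:E < +oo -> L1 F.
Proof.
move=> mF Foo; have mnF := cmeasurable_norm mF; case: mF => mr mi; split.
- apply/integrableP; split; first exact/measurable_EFinP.
  apply: le_lt_trans Foo; apply: ge0_le_integral => //=.
  + by apply/measurable_EFinP/measurableT_comp.
  + exact/measurable_EFinP.
  + by move=> x _; rewrite lee_fin; exact: normr_Re.
- apply/integrableP; split; first exact/measurable_EFinP.
  apply: le_lt_trans Foo; apply: ge0_le_integral => //=.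
  + by apply/measurable_EFinP/measurableT_comp.
  + exact/measurable_EFinP.
  + by move=> x _; rewrite lee_fin; exact: normr_Im.
Qed.

Lemma L1_norm_lty F : L1 F -> \int[mu]_x (`|F x|%R)%:E < +oo.
Proof.
move=> L1F; have mF := L1_cmeasurable L1F; have mnF := cmeasurable_norm mF.
case: L1F mF => /integrableP[_ ir] /integrableP[_ ii] [mr mi].
apply: (@le_lt_trans _ _
    (\int[mu]_x (`|complex.Re (F x)|%:E + `|complex.Im (F x)|%:E))).
  apply: ge0_le_integral => //=.
  - exact/measurable_EFinP.
  - by apply/emeasurable_funD; apply/measurable_EFinP/measurableT_comp.
  - by move=> x _; rewrite lee_fin; exact: Rcomplex_norm_le.
rewrite ge0_integralD//=.
- exact: lte_add_pinfty.
- by apply/measurable_EFinP/measurableT_comp.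
- by apply/measurable_EFinP/measurableT_comp.
Qed.

(** The factor 2 comes from bounding the integrals of the real and imaginary parts separately by
    that of the modulus; the sharp constant 1 would require a rotation argument. *)
Lemma norm_cintegral_le F : cmeasurable F ->
  `|cintegral F|%:E <= 2%:E * \int[mu]_x (`|F x|%R)%:E.
Proof.
move=> mF; have mnF := cmeasurable_norm mF.
(* If the modulus has infinite integral, the right-hand side is [+oo]. *)
have [Foo|] := ltP (\int[mu]_x (`|F x|%R)%:E) +oo; last first.
  by rewrite leye_eq => /eqP ->; rewrite gt0_muley ?leey// lte_fin.
have [Lr Li] := L1P mF Foo.
have bnd (p : R -> R) : mu.-integrable setT (EFin \o p) ->
    (forall x, (`|p x| <= `|F x|)%R) ->
    (`|\int[mu]_x p x|%R)%:E <= \int[mu]_x (`|F x|%R)%:E.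
  move=> ip pF; rewrite EFin_normr_Rintegral//.
  apply: (le_trans (le_abse_integral _ _ (measurable_int mu ip))) => //.
  apply: ge0_le_integral => //=.
  - apply/measurable_EFinP/measurableT_comp => //.
    by apply/measurable_EFinP; exact: (measurable_int mu ip).
  - exact/measurable_EFinP.
  - by move=> x _; rewrite lee_fin.
apply: (@le_trans _ _ ((`|\int[mu]_x complex.Re (F x)|%R)%:E +
                       (`|\int[mu]_x complex.Im (F x)|%R)%:E)).
  by rewrite -EFinD lee_fin; exact: (Rcomplex_norm_le (cintegral F)).
rewrite (_ : 2%:E = 1 + 1)// ge0_muleDl ?lee01// mul1e leeD//.
- by apply: bnd => // x; exact: normr_Re.
- by apply: bnd => // x; exact: normr_Im.
Qed.

Lemma cintegral_linear F G (a : C) : L1 F -> L1 G ->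
  cintegral (fun x => a * F x + G x)%R = (a * cintegral F + cintegral G)%R.
Proof.
move=> [Fr Fi] [Gr Gi].
(* Both components of [a * F + G] are real combinations of three integrable functions: the
   coefficients are [Re a], [- Im a], 1 for the real part and [Re a], [Im a], 1 for the imaginary
   part. *)
have lin (u v : R) (p q r : R -> R) : mu.-integrable setT (EFin \o p) ->
    mu.-integrable setT (EFin \o q) -> mu.-integrable setT (EFin \o r) ->
    (\int[mu]_x (u * p x + v * q x + r x) =
     u * \int[mu]_x p x + v * \int[mu]_x q x + \int[mu]_x r x)%R.
  move=> ip iq ir; have iup := integrableZl measurableT u ip.
  have ivq := integrableZl measurableT v iq.
  rewrite RintegralD//; last exact: (integrableD measurableT iup ivq).
  by rewrite RintegralD// !RintegralZl.
apply/eqP; rewrite eq_complex; apply/andP; split; apply/eqP.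
- rewrite raddfD/= Re_mul/= -mulNr -lin//.
  by apply: eq_Rintegral => x _; rewrite raddfD/= Re_mul mulNr.
- rewrite raddfD/= Im_mul/= -lin//.
  by apply: eq_Rintegral => x _; rewrite raddfD/= Im_mul.
Qed.

Lemma cintegral_shift F a : cmeasurable F ->
  cintegral (fun x => F (x + a)%R) = cintegral F.
Proof.
by move=> [mr mi]; rewrite /cintegral (Rintegral_shift a mr) (Rintegral_shift a mi).
Qed.

Lemma norm_cintegralB_le F G : L1 F -> L1 G ->
  `|cintegral F - cintegral G|%:E <= 2%:E * \int[mu]_x (`|F x - G x|%R)%:E.
Proof.
move=> LF LG.
have -> : (cintegral F - cintegral G = cintegral (fun x => F x - G x))%R.
  rewrite (_ : (fun x => F x - G x)%R = (fun x => -1 * G x + F x)%R).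
    by rewrite cintegral_linear// mulN1r addrC.
  by apply/funext => x; rewrite mulN1r addrC.
apply: norm_cintegral_le; apply: cmeasurableB; exact: L1_cmeasurable.
Qed.

End complex_valued.

(** * Unit windows and uniform local integrability of Stepanov almost automorphic functions *)

Section stepanov.
Context {R : realType}.
Local Notation C := (Rcomplex R).
Local Notation mu := (@lebesgue_measure R).
Implicit Types (f g F G phi : R -> C).
Local Open Scope ereal_scope.

(** After extension by zero, both sides are integrals over the line that differ by the translation
    by [a]. *)
Lemma integral_unit_window (a : R) (p : R -> \bar R) :
  measurable_fun [set: R] p -> (forall x, 0 <= p x) ->
  \int[mu]_(t in `[0%R, 1%R]) p (a + t)%R =
  \int[mu]_(u in `[a, (a + 1)%R]) p u.
Proof.
move=> mp p0; rewrite integral_mkcond [RHS]integral_mkcond.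
rewrite -[RHS](ge0_integral_shift a).
- apply: eq_integral => x _; rewrite !patchE (addrC x a).
  congr (if _ then _ else _); rewrite !mem_setE !in_itv/=.
  by rewrite lerDl lerD2l.
- exact/(measurable_restrictT _ _).1/measurable_funTS.
- by move=> x; exact: erestrict_ge0.
Qed.

Lemma L1loc_lty f (K : set R) : L1loc f -> compact K ->
  \int[mu]_(x in K) (`|f x|%R)%:E < +oo.
Proof.
move=> lf cK; have mK := compact_measurable cK.
have mnf := cmeasurable_norm (L1loc_cmeasurable lf).
case: lf => [[mr _ ir] [mi _ ii]].
apply: (@le_lt_trans _ _ (\int[mu]_(x in K)
    (`|complex.Re (f x)|%:E + `|complex.Im (f x)|%:E))).
  apply: ge0_le_integral => //=.
  - exact/measurable_EFinP/measurable_funTS.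
  - by apply/measurable_funTS/emeasurable_funD;
      apply/measurable_EFinP/measurableT_comp.
  - by move=> x _; rewrite lee_fin; exact: Rcomplex_norm_le.
rewrite ge0_integralD//=.
- by rewrite lte_add_pinfty// ?ir ?ii.
- by apply/measurable_funTS/measurable_EFinP/measurableT_comp.
- by apply/measurable_funTS/measurable_EFinP/measurableT_comp.
Qed.

Lemma near_lt_of_cvg0 (u : nat -> \bar R) (e : R) : (0 < e)%R ->
  u k @[k --> \oo] --> 0 -> \forall k \near \oo, u k < e%:E.
Proof.
move=> e0 /fine_cvgP[finu /cvgrPdist_lt/(_ e e0) ue].
near=> k; have fink : u k \is a fin_num by near: k.
rewrite -(fineK fink) lte_fin; apply: le_lt_trans (ler_norm _) _.
by rewrite -normrN -sub0r; near: k.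
Unshelve. all: by end_near. Qed.

Lemma le_integral_normB (D : set R) F G : measurable D ->
  cmeasurable F -> cmeasurable G ->
  \int[mu]_(x in D) (`|F x|%R)%:E <=
  \int[mu]_(x in D) (`|F x - G x|%R)%:E + \int[mu]_(x in D) (`|G x|%R)%:E.
Proof.
move=> mD mF mG.
have := cmeasurable_norm mF; have := cmeasurable_norm mG.
have := cmeasurable_norm (cmeasurableB mF mG) => nB nG nF.
rewrite -ge0_integralD//=; try exact/measurable_EFinP/measurable_funTS.
apply: ge0_le_integral => //=; try exact/measurable_EFinP/measurable_funTS.
- apply/measurable_funTS/emeasurable_funD; exact/measurable_EFinP.
- by move=> x _; rewrite -EFinD lee_fin -{1}(subrK (G x) (F x)) ler_normD.
Qed.

(* If unit windows at s_m had mass > m, no subsequence of the translates by s_m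
   could converge in L^1 on [0, 1]. *)
Lemma S1_almost_automorphic_bounded f : S1_almost_automorphic f ->
  exists2 M : R, (0 <= M)%R & forall x : R,
    \int[mu]_(t in `[0%R, 1%R]) (`|f (x + t)|%R)%:E <= M%:E.
Proof.
move=> [lf aaf]; apply: contrapT => unb.
have /choice[s sP] : forall m : nat, exists x : R,
    m%:R%:E < \int[mu]_(t in `[0%R, 1%R]) (`|f (x + t)|%R)%:E.
  move=> m; apply: contrapT => nex; apply: unb; exists m%:R => // x.
  by rewrite leNgt; apply/negP => ltm; apply: nex; exists x.
have [sigma [incs [g [lg /(_ 0%R)[cvgf _]]]]] := aaf s.
have mf := L1loc_cmeasurable lf; have mg := L1loc_cmeasurable lg.
set I := \int[mu]_(t in `[0%R, 1%R]) (`|g (0 + t)|%R)%:E.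
have Ioo : I < +oo.
  rewrite /I; under eq_integral do rewrite add0r.
  by apply: L1loc_lty lg _; exact: segment_compact.
have I0 : 0 <= I by exact: integral_ge0.
(* A strictly increasing sequence of indices dominates the identity, so the mass of the window at
   [s (sigma k)] exceeds [k], whereas convergence keeps it below [1 + I]. *)
have lek k : (k <= sigma k)%N.
  elim: k => // k ih; apply: leq_ltn_trans ih _.
  have := incs k.+1 k; rewrite ltnn => /negbT.
  by rewrite -ltNge.
have := near_lt_of_cvg0 (@ltr01 R) cvgf => /= ltk.
near \oo => k.
have kP : (fine I + 1 <= k%:R)%R by near: k; exact: nbhs_infty_ger.
have : (sigma k)%:R%:E < 1%:E + I.
  apply: lt_le_trans (sP (sigma k)) _.
  apply: (@le_trans _ _ (\int[mu]_(t in `[0%R, 1%R])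
     (`|f (0 + s (sigma k) + t) - g (0 + t)|%R)%:E + I)).
    under eq_integral do rewrite -{1}(add0r (s _)).
    by apply: le_integral_normB => //; exact: cmeasurable_shiftl.
  by rewrite leeD2r// ltW//; near: k.
rewrite -(@fineK _ I) ?ge0_fin_numE// -EFinD lte_fin addrC ltNge => /negP.
by apply; apply: le_trans kP _; rewrite ler_nat.
Unshelve. all: by end_near. Qed.

End stepanov.

(** * Pointwise control of a smooth function by local integrals, and the Tonelli estimate *)

Section bounded.
Context {R : realType}.
Local Notation C := (Rcomplex R).
Local Notation mu := (@lebesgue_measure R).
Implicit Types (f g F G phi : R -> C).
Local Open Scope ereal_scope.

(** By the fundamental theorem of calculus, [p y] and [p t] differ by at most the integral [J] of
    the modulus of the derivative over the window; averaging over [t] in the window, which has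
    length 1, gives the bound. *)
Lemma norm_le_integral_unit (p : R -> R) (y : R) :
  (forall x, derivable p x 1) -> continuous p^`()%classic ->
  `|p y|%:E <= \int[mu]_(t in `[y, (y + 1)%R]) (`|p t| + `|p^`()%classic t|)%:E.
Proof.
move=> dp cp'; have cp : continuous p.
  by move=> x; apply/differentiable_continuous/derivable1_diffP.
have mp : measurable_fun setT p by exact: continuous_measurable_fun.
have mp' : measurable_fun setT p^`()%classic by exact: continuous_measurable_fun.
have mnp D : measurable_fun D (fun x => (`|p x|)%:E).
  by apply/measurable_funTS/measurable_EFinP/measurableT_comp.
have mnp' D : measurable_fun D (fun x => (`|p^`()%classic x|)%:E).
  by apply/measurable_funTS/measurable_EFinP/measurableT_comp.
set J := \int[mu]_(t in `[y, (y + 1)%R]) (`|p^`()%classic t|)%:E.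
have J0 : 0 <= J by exact: integral_ge0.
have mu1 : mu `[y, (y + 1)%R] = 1.
  by rewrite lebesgue_measure_itv/= lte_fin ltrDl ltr01 -EFinB addrAC subrr add0r.
have pyt t : (y <= t <= y + 1)%R -> `|p y|%:E <= `|p t|%:E + J.
  (* The case [t = y] is treated apart, since the fundamental theorem is applied on a nondegenerate
     interval. *)
  move=> /andP[+ ty]; rewrite le_eqVlt => /predU1P[<-|yt]; first by rewrite leeDl.
  have FTC : \int[mu]_(x in `[y, t]) (p^`()%classic x)%:E = (p t)%:E - (p y)%:E.
    apply: continuous_FTC2 => //; first exact: continuous_subspaceT.
    by split=> [x _||]; [exact: dp|exact/cvg_at_right_filter/cp|
      exact/cvg_at_left_filter/cp].
  have pJ : `|p t - p y|%:E <= J.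
    rewrite -abse_EFin EFinB -FTC; apply: (le_trans (le_abse_integral _ _ _)) => //=.
      exact/measurable_funTS/measurable_EFinP.
    apply: ge0_subset_integral => //=; first exact: mnp'.
    move=> x; rewrite /= !in_itv/= => /andP[-> /le_trans]/=.
    by apply.
  apply: le_trans (leeD2l _ pJ); rewrite -EFinD lee_fin.
  by rewrite -{1}(subKr (p t) (p y)); exact: ler_normB.
have -> : `|p y|%:E = \int[mu]_(t in `[y, (y + 1)%R]) `|p y|%:E.
  by rewrite integral_cst//= mu1 mule1.
apply: (@le_trans _ _ (\int[mu]_(t in `[y, (y + 1)%R]) (`|p t|%:E + J))).
  apply: ge0_le_integral => //=.
  by apply: emeasurable_funD; [exact: mnp|exact: measurable_cst].
rewrite ge0_integralD//=; last by exact: mnp.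
rewrite integral_cst//= mu1 mule1.
under [leRHS]eq_integral do rewrite EFinD.
rewrite ge0_integralD//=; [exact: mnp|exact: mnp'].
Qed.

(** [Re] is real-linear and continuous, so it commutes with difference quotients and with their
    limit. *)
Lemma derivable_Re phi x : derivable phi x 1 ->
  derivable (fun y => complex.Re (phi y)) x 1 /\
  (fun y => complex.Re (phi y))^`()%classic x = complex.Re (phi^`()%classic x).
Proof.
move=> dphi; have Recvg : ((@complex.Re R : C -> R) \o
    (fun h : R => h^-1 *: ((phi \o shift x) (h *: 1) - phi x)))%R
    @ (0%R : R)^' --> complex.Re ('D_1 phi x).
  exact: (cvg_comp _ _ dphi (@Re_continuous R _)).
have : ((fun h : R => h^-1 *:
    (((fun y => complex.Re (phi y)) \o shift x) (h *: 1) - complex.Re (phi x)))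
    @ (0%R : R)^' --> complex.Re ('D_1 phi x))%R.
  apply: cvg_trans Recvg; apply: near_eq_cvg; near=> h.
  by rewrite /= linearZ/= raddfB.
move=> cvgRe; split; first by apply/cvg_ex; exists (complex.Re ('D_1 phi x)).
by rewrite !derive1E; exact: cvg_lim cvgRe.
Unshelve. all: by end_near. Qed.

Lemma derivable_Im phi x : derivable phi x 1 ->
  derivable (fun y => complex.Im (phi y)) x 1 /\
  (fun y => complex.Im (phi y))^`()%classic x = complex.Im (phi^`()%classic x).
Proof.
move=> dphi; have Imcvg : ((@complex.Im R : C -> R) \o
    (fun h : R => h^-1 *: ((phi \o shift x) (h *: 1) - phi x)))%R
    @ (0%R : R)^' --> complex.Im ('D_1 phi x).
  exact: (cvg_comp _ _ dphi (@Im_continuous R _)).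
have : ((fun h : R => h^-1 *:
    (((fun y => complex.Im (phi y)) \o shift x) (h *: 1) - complex.Im (phi x)))
    @ (0%R : R)^' --> complex.Im ('D_1 phi x))%R.
  apply: cvg_trans Imcvg; apply: near_eq_cvg; near=> h.
  by rewrite /= linearZ/= raddfB.
move=> cvgIm; split; first by apply/cvg_ex; exists (complex.Im ('D_1 phi x)).
by rewrite !derive1E; exact: cvg_lim cvgIm.
Unshelve. all: by end_near. Qed.

Lemma derivable_continuous phi : (forall x, derivable phi x 1) -> continuous phi.
Proof. by move=> d x; exact/differentiable_continuous/derivable1_diffP. Qed.

Lemma smooth_continuous i phi : smooth phi -> continuous (derive1n i phi).
Proof. by move=> sphi; exact: derivable_continuous (sphi i). Qed.

(** The real estimate is applied to [Re] and [Im] of [phi], each dominated by the modulus along with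
    its derivative; adding the two produces the factor 2. *)
Lemma smooth_norm_le_integral_unit phi (y : R) : smooth phi ->
  (`|phi y|%R)%:E <= 2%:E *
    \int[mu]_(t in `[y, (y + 1)%R]) (`|phi t|%R + `|derive1n 1%N phi t|%R)%:E.
Proof.
move=> sphi; have dphi := sphi 0%N; have cphi := smooth_continuous (i := 0%N) sphi.
have cphi' := smooth_continuous (i := 1%N) sphi.
have mp := continuous_cmeasurable cphi; have mp' := continuous_cmeasurable cphi'.
have bnd (c : C -> R) : continuous c -> (forall z, `|c z| <= `|z|)%R ->
   (forall x, derivable (c \o phi) x 1 /\
      (c \o phi)^`()%classic x = c (phi^`()%classic x)) ->
   `|c (phi y)|%:E <=
    \int[mu]_(t in `[y, (y + 1)%R]) (`|phi t|%R + `|derive1n 1%N phi t|%R)%:E.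
  move=> cc cle /all_and2[dc cE].
  have dcE : (c \o phi)^`()%classic = c \o derive1n 1%N phi.
    by apply/funext => x; exact: cE.
  have ccp' : continuous (c \o derive1n 1%N phi).
    by move=> x; exact: (continuous_comp (cphi' x) (cc _)).
  have ccp : continuous (c \o phi).
    by move=> x; exact: (continuous_comp (cphi x) (cc _)).
  apply: (le_trans (@norm_le_integral_unit (c \o phi) y dc _)); rewrite dcE//.
  apply: ge0_le_integral => //=.
  - apply/measurable_funTS/measurable_EFinP/measurable_funD;
      by apply: measurableT_comp => //; exact: continuous_measurable_fun.
  - apply/measurable_funTS/measurable_EFinP.
    by apply: measurable_funD; exact: cmeasurable_norm.
  - by move=> x _; rewrite lee_fin lerD.
apply: (@le_trans _ _ (`|complex.Re (phi y)|%:E + `|complex.Im (phi y)|%:E)).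
  by rewrite -EFinD lee_fin Rcomplex_norm_le.
rewrite (_ : 2%:E = 1 + 1)// ge0_muleDl ?lee01// mul1e leeD//.
- apply: (bnd (@complex.Re R)); [exact: Re_continuous|exact: normr_Re|].
  by move=> x; exact: derivable_Re.
- apply: (bnd (@complex.Im R)); [exact: Im_continuous|exact: normr_Im|].
  by move=> x; exact: derivable_Im.
Qed.

(** Replacing the modulus of [phi y] by its window integral and exchanging the integrals, each [t]
    meets exactly the [y] in [[t - 1, t]], a unit window on which [f] has mass at most [M]. *)
Lemma integral_mul_average_le f phi (M : R) (W : R -> R) :
  cmeasurable f -> cmeasurable phi ->
  (forall x : R, \int[mu]_(t in `[0%R, 1%R]) (`|f (x + t)|%R)%:E <= M%:E) ->
  measurable_fun setT W -> (forall t, 0 <= W t)%R ->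
  (forall y, (`|phi y|%R)%:E <= \int[mu]_(t in `[y, (y + 1)%R]) (W t)%:E) ->
  \int[mu]_y (`|f y * phi y : C|%R)%:E <= M%:E * \int[mu]_t (W t)%:E.
Proof.
move=> mf mphi fM mW W0 phiW; have mnf := cmeasurable_norm mf.
have mnfphi := cmeasurable_norm (cmeasurableM mf mphi).
pose I : set R := `[0%R, 1%R].
(* The constraint that [t] lies in [[y, y + 1]] is written as an indicator of [t - y], which makes
   the kernel jointly measurable on the plane. *)
pose k (z : R * R) : \bar R := (`|f z.1| * (W z.2 * \1_I (z.2 - z.1)))%:E.
have mk : measurable_fun setT k.
  apply/measurable_EFinP; apply: measurable_funM.
    exact: (measurableT_comp mnf).
  apply: measurable_funM; first exact: (measurableT_comp mW).
  have mI : measurable_fun setT (\1_I : R -> R)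
    by apply: measurable_indic; rewrite /I; exact: measurable_itv.
  apply: (measurableT_comp mI).
  by apply: measurable_funB; [exact: measurable_snd|exact: measurable_fst].
have k0 z : 0 <= k z by rewrite lee_fin !mulr_ge0.
apply: (@le_trans _ _ (\int[mu]_y \int[mu]_t k (y, t))).
  apply: ge0_le_integral => //=.
  - exact/measurable_EFinP.
  - exact: (@measurable_fun_fubini_tonelli_F _ _ _ _ _ mu k).
  move=> y _; rewrite Rcomplex_normM EFinM.
  apply: (le_trans (lee_wpmul2l _ (phiW y))); first by rewrite lee_fin.
  rewrite -ge0_integralZl//=; last 2 first.
    exact/measurable_funTS/measurable_EFinP.
    by move=> t _; rewrite lee_fin.
  rewrite integral_mkcond le_eqVlt; apply/orP; left; apply/eqP.
  apply: eq_integral => t _.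
  rewrite patchE /k/= indicE mem_setE/= in_itv/= !mem_setE !in_itv/=.
  rewrite subr_ge0 lerBlDl.
  by case: ifPn => _; rewrite ?mulr1 ?mulr0// EFinM.
rewrite fubini_tonelli//.
rewrite -ge0_integralZl//=; last 3 first.
  exact/measurable_EFinP.
  by move=> t _; rewrite lee_fin.
  (* Nonnegativity of [M] follows because it bounds the mass of a window. *)
  by apply: le_trans (fM 0%R); exact: integral_ge0.
apply: ge0_le_integral => //=.
- by move=> t _; exact: integral_ge0.
- apply: (@measurable_fun_fubini_tonelli_G _ _ _ _ _ mu k) => //.
- by apply: measurable_funeM; exact/measurable_EFinP.
move=> t _; rewrite [leRHS]muleC.
have -> : \int[mu]_y k (y, t) =
    (W t)%:E * \int[mu]_(u in `[0%R, 1%R]) (`|f (t - 1 + u)|%R)%:E.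
  rewrite (integral_unit_window (t - 1)%R (p := fun u => (`|f u|%R)%:E))//; last first.
    exact/measurable_EFinP.
  rewrite -ge0_integralZl//=; last 2 first.
    exact/measurable_funTS/measurable_EFinP.
    by rewrite lee_fin.
  rewrite [RHS]integral_mkcond; apply: eq_integral => y _.
  rewrite patchE /k/= indicE mem_setE/= in_itv/= !mem_setE !in_itv/=.
  rewrite subrK subr_ge0 lerBlDl lerBlDr andbC addrC.
  by case: ifPn => _; rewrite ?mulr1 ?mulr0// mulrC EFinM.
by rewrite lee_wpmul2l// lee_fin.
Qed.

End bounded.

(** * Test functions inside D_{L^1} and the pairing of [f] with D_{L^1} *)

Section duality.
Context {R : realType}.
Local Notation C := (Rcomplex R).
Local Notation mu := (@lebesgue_measure R).
Implicit Types (f g F G phi psi : R -> C).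

(** The complement of the support is open, so each derivative vanishes near the point and the next
    one vanishes at it. *)
Lemma notin_supp_derive1n i phi x : ~ supp phi x -> derive1n i phi x = 0.
Proof.
have osupp : open (~` supp phi) by apply: closed_openC; exact: closed_closure.
elim: i x => [|i ih] x nx.
  rewrite derive1n0; apply: contrapT => /eqP phix; apply: nx.
  exact: subset_closure.
rewrite derive1nS derive1E.
have := @near_eq_derive R _ _ (derive1n i phi) (cst 0) x 1 => ->.
  by rewrite -derive1E derive1_cst.
have : nbhs x (~` supp phi) by exact: open_nbhs_nbhs.
by apply: filterS => y; exact: ih.
Qed.

Lemma continuous_bounded_support F (K : set R) : continuous F -> compact K ->
  (forall x, ~ K x -> F x = 0) ->
  exists2 B : R, 0 <= B & forall x, `|F x| <= B.
Proof.
move=> cF cK F0.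
have /compact_bounded : compact (F @` K).
  by apply: continuous_compact => //; exact: continuous_subspaceT.
(* Every real above [M] is a bound; this one is moreover nonnegative. *)
move=> [M [_ MF]]; exists (`|M| + 1); first by rewrite addr_ge0.
move=> x; have [Kx|nKx] := pselect (K x); last by rewrite F0// normr0 addr_ge0.
apply: (MF (`|M| + 1)); last by exists x.
by rewrite (le_lt_trans (ler_norm M))// ltrDl.
Qed.

Local Open Scope ereal_scope.

Lemma integral_norm_mul_le F G (K : set R) (B : R) : measurable K ->
  cmeasurable F -> (0 <= B)%R -> (forall x, `|G x| <= B)%R ->
  (forall x, ~ K x -> G x = 0%R) -> cmeasurable G ->
  \int[mu]_x (`|F x * G x : C|%R)%:E <= B%:E * \int[mu]_(x in K) (`|F x|%R)%:E.
Proof.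
move=> mK mF B0 GB G0 mG; have mnF := cmeasurable_norm mF.
have mnFG := cmeasurable_norm (cmeasurableM mF mG).
rewrite -ge0_integralZl//=; last exact/measurable_funTS/measurable_EFinP.
rewrite [leRHS]integral_mkcond; apply: ge0_le_integral => //=.
- exact/measurable_EFinP.
- apply/(measurable_restrictT _ _).1 => //; apply/measurable_funTS.
  by apply: measurable_funeM; exact/measurable_EFinP.
- move=> x _; rewrite patchE Rcomplex_normM; case: ifPn => [_|].
    by rewrite -EFinM lee_fin mulrC ler_wpM2r.
  by rewrite notin_setE => /G0 ->; rewrite normr0 mulr0.
Qed.

Lemma L1_mul_bounded_support F G (K : set R) (B : R) : compact K -> L1loc F ->
  (0 <= B)%R -> (forall x, `|G x| <= B)%R ->
  (forall x, ~ K x -> G x = 0%R) -> cmeasurable G -> L1 (fun x => F x * G x)%R.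
Proof.
move=> cK lF B0 GB G0 mG; have mF := L1loc_cmeasurable lF.
apply: L1P; first exact: cmeasurableM.
apply: le_lt_trans (integral_norm_mul_le (compact_measurable cK) mF B0 GB G0 mG) _.
by rewrite lte_mul_pinfty// L1loc_lty.
Qed.

Lemma test_function_DL1 phi : test_function phi -> DL1 phi.
Proof.
move=> [sphi cphi]; split => // i.
have ci := @smooth_continuous _ i _ sphi.
have [B B0 phiB] := continuous_bounded_support ci cphi (@notin_supp_derive1n i phi).
apply: L1P; first exact: continuous_cmeasurable.
have mi := continuous_cmeasurable ci.
(* Taking the constant 1 as first factor in [integral_norm_mul_le] bounds the integral by [B] times
   the measure of the support. *)
have m1 : cmeasurable (fun=> 1%R : C) by split; exact: measurable_cst.
apply: (@le_lt_trans _ _ (\int[mu]_x (`|1 * derive1n i phi x : C|%R)%:E)).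
  by under [leRHS]eq_integral do rewrite mul1r.
apply: (le_lt_trans (integral_norm_mul_le (compact_measurable cphi) m1 B0 phiB
  (@notin_supp_derive1n i phi) mi)).
rewrite lte_mul_pinfty//.
rewrite (_ : (fun _ => _) = cst (`|1 : C|%R)%:E)// integral_cst.
  by rewrite lte_mul_pinfty// compact_finite_measure.
exact: compact_measurable.
Qed.

Lemma derive1nB i phi psi : smooth phi -> smooth psi ->
  derive1n i (phi \- psi)%R = (derive1n i phi \- derive1n i psi)%R.
Proof.
move=> sphi spsi; elim: i => // i ih.
apply/funext => x; rewrite !derive1nS ih !derive1E.
by rewrite (deriveB (sphi i x) (spsi i x)) /= !derive1E.
Qed.

Lemma smoothB phi psi : smooth phi -> smooth psi -> smooth (phi \- psi)%R.
Proof.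
move=> sphi spsi i x; rewrite derive1nB//.
exact: derivableB (sphi i x) (spsi i x).
Qed.

(** This estimate yields both the convergence of the pairing on D_{L^1} and its continuity there. *)
Lemma integral_norm_mul_DL1_norm_le f phi (M : R) : cmeasurable f ->
  (forall x : R, \int[mu]_(t in `[0%R, 1%R]) (`|f (x + t)|%R)%:E <= M%:E) ->
  smooth phi ->
  \int[mu]_x (`|f x * phi x : C|%R)%:E <= (2 * M)%:E * DL1_norm 1 phi.
Proof.
move=> mf fM sphi; have mnf := cmeasurable_norm mf.
have mphi := continuous_cmeasurable (@smooth_continuous _ 0%N _ sphi).
have mphi' := continuous_cmeasurable (@smooth_continuous _ 1%N _ sphi).
have mnphi := cmeasurable_norm mphi; have mnphi' := cmeasurable_norm mphi'.
have mnfphi := cmeasurable_norm (cmeasurableM mf mphi).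
(* The integral of [W] is [DL1_norm 1 phi]; the weight passed to the averaging lemma is [2 * W],
   which absorbs the factor of [smooth_norm_le_integral_unit]. *)
pose W t : R := (`|phi t| + `|derive1n 1%N phi t|)%R.
have mW : measurable_fun setT W by exact: measurable_funD.
have W0 t : (0 <= W t)%R by rewrite addr_ge0.
have WE : DL1_norm 1 phi = \int[mu]_t (W t)%:E.
  rewrite /DL1_norm !big_ord_recr big_ord0/= add0e -ge0_integralD//=.
  - exact/measurable_EFinP.
  - exact/measurable_EFinP.
pose A y := \int[mu]_(t in `[y, (y + 1)%R]) (2 * W t)%:E.
have W20 t : (0 <= 2 * W t)%R by rewrite mulr_ge0.
have mW2 : measurable_fun setT (fun t => 2 * W t)%R by exact: measurable_funM.
have phiW y : (`|phi y|%R)%:E <= A y.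
  apply: (le_trans (smooth_norm_le_integral_unit y sphi)).
  rewrite -ge0_integralZl//=; last exact/measurable_funTS/measurable_EFinP.
apply: (le_trans (integral_mul_average_le mf mphi fM mW2 W20 phiW)).
under eq_integral do rewrite EFinM.
rewrite ge0_integralZl//=; last 2 first.
  exact/measurable_EFinP.
  by move=> t _; rewrite lee_fin.
by rewrite -WE muleA -EFinM (mulrC M).
Qed.

Lemma L1_mul_DL1 f phi (M : R) : cmeasurable f ->
  (forall x : R, \int[mu]_(t in `[0%R, 1%R]) (`|f (x + t)|%R)%:E <= M%:E) ->
  (0 <= M)%R -> DL1 phi -> L1 (fun t => f t * phi t)%R.
Proof.
move=> mf fM M0 [sphi L1phi]; have cphi := @smooth_continuous _ 0%N _ sphi.
apply: L1P; first exact: cmeasurableM (continuous_cmeasurable cphi).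
apply: (le_lt_trans (integral_norm_mul_DL1_norm_le mf fM sphi)).
rewrite lte_mul_pinfty ?lee_fin ?mulr_ge0//.
rewrite /DL1_norm !big_ord_recr big_ord0/= add0e.
by rewrite lte_add_pinfty//; apply: L1_norm_lty; [exact: (L1phi 0%N)|exact: (L1phi 1%N)].
Qed.

End duality.

(** * Regularisations of [f]: translation, convergence and continuity *)

Section regularisation.
Context {R : realType}.
Local Notation C := (Rcomplex R).
Local Notation mu := (@lebesgue_measure R).
Implicit Types (f g F G phi psi : R -> C).

Lemma lipschitz_bounded_derive1 (p : R -> R) (B : R) :
  (forall x, derivable p x 1) -> (forall x, `|p^`()%classic x| <= B) ->
  forall a b, `|p a - p b| <= B * `|a - b|.
Proof.
move=> dp pB.
have lt a b : a < b -> `|p b - p a| <= B * `|b - a|.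
  move=> ab; have [||c _ ->] := MVT ab (f := p) (df := p^`()%classic).
  - by move=> x _; rewrite derive1E; exact: derivableP.
  - apply: continuous_subspaceT => x.
    exact/differentiable_continuous/derivable1_diffP.
  - by rewrite normrM ler_wpM2r.
move=> a b; have [ab|ba|->] := ltgtP a b; last by rewrite !subrr normr0 mulr0.
- by rewrite distrC (distrC a); exact: lt.
- exact: lt.
Qed.

(** The mean value theorem is a real statement, so it is applied to [Re] and [Im] separately, whence
    the constant [B + B]. *)
Lemma test_function_lipschitz phi : test_function phi ->
  exists2 L : R, 0 <= L & forall a b, `|phi a - phi b| <= L * `|a - b|.
Proof.
move=> [sphi cphi]; have dphi := sphi 0%N.
have [B B0 phiB] := continuous_bounded_support
  (@smooth_continuous _ 1%N _ sphi) cphi (@notin_supp_derive1n _ 1%N phi).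
exists (B + B); first by rewrite addr_ge0.
move=> a b; apply: le_trans (Rcomplex_norm_le _) _; rewrite !raddfB/= mulrDl.
apply: lerD.
- apply: (@lipschitz_bounded_derive1 (fun x => complex.Re (phi x))) => x.
    by have [] := derivable_Re (dphi x).
  by have [_ ->] := derivable_Re (dphi x); exact: le_trans (normr_Re _) (phiB x).
- apply: (@lipschitz_bounded_derive1 (fun x => complex.Im (phi x))) => x.
    by have [] := derivable_Im (dphi x).
  by have [_ ->] := derivable_Im (dphi x); exact: le_trans (normr_Im _) (phiB x).
Qed.

(** The radius [N] is an integer so that [[x - N, x + N]] splits into [N + N] unit windows. *)
Lemma test_function_window phi : test_function phi ->
  exists (N : nat) (B : R), [/\ 0 <= B, forall y, `|phi y| <= B &
    forall x y : R, ~~ (x - N%:R <= y <= x + N%:R) -> phi (x - y) = 0].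
Proof.
move=> [sphi cphi].
have [B B0 phiB] := continuous_bounded_support
  (@smooth_continuous _ 0%N _ sphi) cphi (@notin_supp_derive1n _ 0%N phi).
have [M [_ MK]] := compact_bounded cphi.
have [N MN] : exists N : nat, `|M| + 1 <= N%:R.
  exists (Num.truncn (`|M| + 1)).+1; exact/ltW/truncnS_gt.
exists N, B; split=> // x y; apply: contraNeq => phixy.
have : `|x - y| <= N%:R.
  apply: le_trans MN; apply: MK; last exact: subset_closure.
  by rewrite (le_lt_trans (ler_norm M))// ltrDl.
by rewrite ler_norml => /andP[h1 h2]; apply/andP; split; lra.
Qed.

Lemma continuous_reflect phi x : continuous phi ->
  continuous (fun y => phi (x - y)).
Proof.
move=> cphi y.
apply: (@continuous_comp _ _ _ (fun y => x - y) phi); last exact: cphi.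
by apply: cvgB; [exact: cvg_cst|exact: cvg_id].
Qed.

Local Open Scope ereal_scope.

(** Unit intervals are split off at the right end by induction; the last one is first taken open on
    the left, for disjointness, then enlarged to a closed window. *)
Lemma integral_windows_le F (c : R) (n : nat) : cmeasurable F ->
  \int[mu]_(u in `[c, (c + n%:R)%R]) (`|F u|%R)%:E <=
  \sum_(i < n) \int[mu]_(t in `[0%R, 1%R]) (`|F (c + i%:R + t)|%R)%:E.
Proof.
move=> mF; have mnF := cmeasurable_norm mF.
have mE : measurable_fun setT (fun u => (`|F u|%R)%:E) by exact/measurable_EFinP.
elim: n => [|n ih].
  by rewrite addr0 big_ord0 set_itv1 integral_set1.
rewrite big_ord_recr/=; apply: le_trans (leeD2r _ ih).
rewrite (integral_unit_window (c + n%:R)%R (p := fun u => (`|F u|%R)%:E))//.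
have -> : `[c, (c + n.+1%:R)%R]%classic =
    `[c, (c + n%:R)%R] `|` `](c + n%:R)%R, (c + n%:R + 1)%R].
  rewrite -natr1 addrA; apply/seteqP; split => u /=; rewrite !in_itv/=.
    move=> /andP[cu ->]; rewrite cu andbT/=.
    by case: (leP u (c + n%:R)%R); [left|right].
  have : (0 <= n%:R :> R)%R by [].
  by move=> n0 [/andP[h1 h2]|/andP[h1 h2]]; apply/andP; split; lra.
rewrite ge0_integral_setU//=.
- rewrite leeD2l//; apply: ge0_subset_integral => //=.
    exact: measurable_funTS.
  by move=> u /=; rewrite !in_itv/= => /andP[/ltW -> ->].
- exact: measurable_funTS.
- apply/disj_setPS => u /= []; rewrite !in_itv/= => /andP[_ h] /andP[h' _].
  by move: h'; rewrite ltNge h.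
Qed.

Lemma convolution_L1 f phi x : L1loc f -> test_function phi ->
  L1 (fun y => f y * phi (x - y))%R.
Proof.
move=> lf tphi; have [N [B [B0 phiB phi0]]] := test_function_window tphi.
have cphi := @smooth_continuous _ 0%N _ tphi.1.
apply: (@L1_mul_bounded_support _ f (fun y => phi (x - y)%R)
  `[(x - N%:R)%R, (x + N%:R)%R] B) => //.
- exact: segment_compact.
- by move=> y; rewrite /= in_itv/= => /negP; exact: phi0.
- exact/continuous_cmeasurable/continuous_reflect.
Qed.

(** The substitution of [y + r] for [y] moves the translation from [phi] onto [f]. *)
Lemma convolution_translate f phi x (r : R) : L1loc f -> test_function phi ->
  L1 (fun y => f (y + r) * phi (x - y))%R /\
  convolution (distribution_of f) phi (x + r) =
    cintegral (fun y => f (y + r) * phi (x - y))%R.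
Proof.
move=> lf tphi; have L1f := convolution_L1 (x + r) lf tphi.
have mF := L1_cmeasurable L1f.
have E : (fun y => f (y + r) * phi (x - y))%R =
         (fun y => f (y + r) * phi (x + r - (y + r)))%R.
  by apply/funext => y; congr (_ * phi _)%R; rewrite opprD addrACA subrr addr0.
rewrite E; split; last first.
  by rewrite (cintegral_shift r mF).
apply: L1P; first exact: (cmeasurable_shift r mF).
rewrite (ge0_integral_shift r (f := fun y => (`|f y * phi (x + r - y) : C|%R)%:E))//.
  exact: L1_norm_lty L1f.
by apply/measurable_EFinP; exact: (cmeasurable_norm mF).
Qed.

(** An arbitrary sequence [r] and pair [f], [g] allow both limits of almost automorphy to be
    obtained, the second with [f] and [g] exchanged and the shifts negated. *)
Lemma convolution_translate_cvg f g phi (r : nat -> R) (x : R) :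
  L1loc f -> L1loc g -> test_function phi ->
  (forall y : R, \int[mu]_(t in `[0%R, 1%R])
    (`|f (y + r k + t) - g (y + t)|%R)%:E @[k --> \oo] --> 0) ->
  convolution (distribution_of f) phi (x + r k)%R @[k --> \oo] -->
  convolution (distribution_of g) phi x.
Proof.
move=> lf lg tphi fg; have [N [B [B0 phiB phi0]]] := test_function_window tphi.
have cphi := @smooth_continuous _ 0%N _ tphi.1.
have mf := L1loc_cmeasurable lf; have mg := L1loc_cmeasurable lg.
pose c := (x - N%:R)%R.
(* The 2 comes from [norm_cintegralB_le], [B] bounds [phi], and the [N + N] unit windows starting at
   [c] cover the support of [phi (x - y)] in [y]. *)
pose v k := (2 * B)%:E * \sum_(i < N + N)
  \int[mu]_(t in `[0%R, 1%R]) (`|f (c + i%:R + r k + t) - g (c + i%:R + t)|%R)%:E.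
have v0 : v k @[k --> \oo] --> 0.
  rewrite -[X in _ --> X](mule0 (2 * B)%:E); apply: cvgeZl => //.
  have sum0 : \sum_(i < N + N) 0%R%:E = 0 :> \bar R by exact: big1.
  rewrite -[X in _ --> X]sum0.
  by apply: cvg_nnesum => // i _; apply: nearW => k; exact: integral_ge0.
have mphix : cmeasurable (fun y => phi (x - y)%R).
  exact/continuous_cmeasurable/continuous_reflect.
have bnd k : (`|convolution (distribution_of g) phi x -
    convolution (distribution_of f) phi (x + r k)|%R)%:E <= v k.
  have [L1f ->] := convolution_translate x (r k) lf tphi.
  have L1g := convolution_L1 x lg tphi.
  rewrite distrC; apply: (le_trans (norm_cintegralB_le L1f L1g)).
  rewrite /v EFinM -muleA lee_wpmul2l//.
  have mF : cmeasurable (fun u => f (u + r k) - g u)%R.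
    by apply: cmeasurableB => //; exact: cmeasurable_shift.
  under eq_integral do rewrite -mulrBl.
  apply: (le_trans (@integral_norm_mul_le _ (fun u => f (u + r k) - g u)%R
    (fun y => phi (x - y)%R) `[c, (c + (N + N)%:R)%R] B _ mF B0 _ _ mphix)) => //.
    move=> y; rewrite /= in_itv/= natrD /c addrA subrK => /negP; exact: phi0.
  rewrite lee_wpmul2l// ?lee_fin//; apply: (le_trans (integral_windows_le _ _ mF)).
  apply: lee_sum => i _; rewrite le_eqVlt; apply/orP; left; apply/eqP.
  by apply: eq_integral => t _; rewrite (addrAC _ t).
apply/cvgrPdist_lt => e e0; have := near_lt_of_cvg0 e0 v0; apply: filterS => k.
by rewrite -lte_fin; exact: le_lt_trans.
Qed.

(** The regularisation inherits a local Lipschitz bound from [phi], with constant proportional to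
    the mass of [f] on a fixed compact interval. *)
Lemma convolution_continuous f phi : L1loc f -> test_function phi ->
  continuous (convolution (distribution_of f) phi).
Proof.
move=> lf tphi x; have [N [B [B0 phiB phi0]]] := test_function_window tphi.
have [L L0 phiL] := test_function_lipschitz tphi.
have cphi := @smooth_continuous _ 0%N _ tphi.1.
have mf := L1loc_cmeasurable lf.
have mphix z : cmeasurable (fun y => phi (z - y)%R).
  exact/continuous_cmeasurable/continuous_reflect.
(* The extra 1 on each side lets a single [K] serve every [z] at distance less than 1 from [x]. *)
pose K := `[(x - 1 - N%:R)%R, (x + 1 + N%:R)%R]%classic.
have cK : compact K by exact: segment_compact.
set J := \int[mu]_(y in K) (`|f y|%R)%:E.
have Joo : J < +oo by exact: L1loc_lty.
have J0 : 0 <= J by exact: integral_ge0.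
have Jfin : J \is a fin_num by rewrite ge0_fin_numE.
pose h := convolution (distribution_of f) phi.
have bnd z : (`|x - z| < 1)%R -> (`|h x - h z| <= 2 * fine J * L * `|x - z|)%R.
  move=> xz1; rewrite -lee_fin.
  apply: (le_trans (norm_cintegralB_le (convolution_L1 x lf tphi)
    (convolution_L1 z lf tphi))).
  rewrite -!mulrA EFinM lee_wpmul2l//.
  under eq_integral do rewrite -mulrBr.
  apply: (le_trans (@integral_norm_mul_le _ f (fun y => phi (x - y) - phi (z - y))%R
    K (L * `|x - z|)%R (compact_measurable cK) mf _ _ _ _)).
  - by rewrite mulr_ge0.
  - move=> y; apply: (le_trans (phiL _ _)).
    by rewrite opprB addrA subrK.
  - move: xz1; rewrite ltr_norml => /andP[xz1 xz2].
    move=> y; rewrite /K /= in_itv/= => /negP xy.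
    rewrite !phi0 ?subrr//; apply: contra xy => /andP[h1 h2];
      by apply/andP; split; lra.
  - exact: cmeasurableB.
  by rewrite -/J -{1}(fineK Jfin) -EFinM lee_fin [leRHS]mulrC.
apply/cvgrPdist_lt => e e0.
(* Adding 1 keeps the divisor positive when [J] or [L] is zero. *)
have d0 : (0 < 2 * fine J * L + 1)%R.
  by rewrite ltr_wpDl// !mulr_ge0// fine_ge0.
have ed0 : (0 < e / (2 * fine J * L + 1))%R by rewrite divr_gt0.
near=> z; apply: (@le_lt_trans _ _ ((2 * fine J * L + 1) * `|x - z|)%R).
  apply: le_trans (bnd z _) _; last by rewrite ler_wpM2r// lerDl.
  by near: z; exact: cvgr_dist_lt.
rewrite mulrC -ltr_pdivlMr; last exact: d0.
near: z; exact: cvgr_dist_lt.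
Unshelve. all: by end_near. Qed.

End regularisation.

(** * The distribution of [f]: continuity, boundedness and almost automorphy *)

Section main.
Context {R : realType}.
Local Notation C := (Rcomplex R).
Local Notation mu := (@lebesgue_measure R).
Implicit Types (f g F G phi psi : R -> C).
Local Open Scope ereal_scope.

Lemma distribution_of_linear_DL1 f (M : R) : cmeasurable f ->
  (forall x : R, \int[mu]_(t in `[0%R, 1%R]) (`|f (x + t)|%R)%:E <= M%:E) ->
  (0 <= M)%R -> linear_on DL1 (distribution_of f).
Proof.
move=> mf fM M0 a phi psi dphi dpsi.
rewrite -(cintegral_linear _ (L1_mul_DL1 mf fM M0 dphi) (L1_mul_DL1 mf fM M0 dpsi)).
by congr cintegral; apply/funext => t; rewrite mulrDr mulrCA.
Qed.

Lemma distribution_of_continuous_DL1 f (M : R) : cmeasurable f ->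
  (forall x : R, \int[mu]_(t in `[0%R, 1%R]) (`|f (x + t)|%R)%:E <= M%:E) ->
  (0 <= M)%R -> DL1_continuous (distribution_of f).
Proof.
(* In [4 * M], one factor 2 comes from [norm_cintegralB_le] and the other from
   [integral_norm_mul_DL1_norm_le]; the added 1 keeps the divisor positive. *)
move=> mf fM M0 phi dphi e e0; exists 1%N, (e / (4 * M + 1))%R.
have d0 : (0 < 4 * M + 1)%R by rewrite ltr_wpDl// mulr_ge0.
split=> [|psi dpsi small]; first by rewrite divr_gt0.
have h1 := norm_cintegralB_le (L1_mul_DL1 mf fM M0 dpsi)
  (L1_mul_DL1 mf fM M0 dphi).
have h2 := integral_norm_mul_DL1_norm_le mf fM (smoothB dpsi.1 dphi.1).
rewrite -lte_fin; apply: (le_lt_trans h1).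
under eq_integral do rewrite -mulrBr.
apply: (@le_lt_trans _ _ (2%:E * ((2 * M)%:E * DL1_norm 1 (psi \- phi)%R))).
  by rewrite lee_wpmul2l.
rewrite muleA -EFinM mulrA.
apply: (@le_lt_trans _ _ ((4 * M + 1)%:E * DL1_norm 1 (psi \- phi)%R)).
  rewrite lee_wpmul2r//; last by rewrite lee_fin; lra.
  by apply: sume_ge0 => i _; exact: integral_ge0.
by rewrite muleC -lte_pdivlMr.
Qed.

Lemma distribution_of_is_distribution f : L1loc f ->
  linear_on DL1 (distribution_of f) -> is_distribution (distribution_of f).
Proof.
move=> lf lin; split.
  by move=> a phi psi /test_function_DL1 dphi /test_function_DL1 dpsi; exact: lin.
move=> K cK; have mK := compact_measurable cK; have mf := L1loc_cmeasurable lf.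
have Joo := L1loc_lty lf cK; set J := \int[mu]_(x in K) _ in Joo.
have J0 : 0 <= J by exact: integral_ge0.
have Jfin : J \is a fin_num by rewrite ge0_fin_numE.
(* A locally integrable function defines a distribution of order 0: on D_K the sup norm suffices,
   with a constant proportional to the mass of [f] on [K]. *)
exists (2 * fine J)%R, 0%N => phi tphi phiK.
have [N [B [B0 phiB _]]] := test_function_window tphi.
have cphi := @smooth_continuous _ 0%N _ tphi.1.
have mphi := continuous_cmeasurable cphi.
rewrite big_ord_recr big_ord0/= add0r.
have phisup x : (`|phi x| <= sup_norm phi)%R.
  by apply: ub_le_sup; [exists B => _ [y _ <-]|exists x].
have sup0 : (0 <= sup_norm phi)%R by exact: le_trans (normr_ge0 _) (phisup 0%R).
have phi0 x : ~ K x -> phi x = 0%R.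
  by move=> nKx; apply: (@notin_supp_derive1n _ 0%N); move=> /phiK.
rewrite -lee_fin; apply: (le_trans (norm_cintegral_le (cmeasurableM mf mphi))).
rewrite -mulrA EFinM lee_wpmul2l//.
apply: (le_trans (integral_norm_mul_le mK mf sup0 phisup phi0 mphi)).
by rewrite -/J -{1}(fineK Jfin) -EFinM lee_fin mulrC.
Qed.

End main.

Theorem proposition10 (R : realType) (f : R -> Rcomplex R)
  (hf : S1_almost_automorphic f) :
  almost_automorphic_distribution (distribution_of f).
Proof.
have [M M0 fM] := S1_almost_automorphic_bounded hf; have [lf aaf] := hf.
have mf := L1loc_cmeasurable lf.
have lin := distribution_of_linear_DL1 mf fM M0.
split.
  split; first exact: distribution_of_is_distribution.
  (* The same integral formula serves as the extension to D_{L^1}. *)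
  exists (distribution_of f); split => //.
  exact: distribution_of_continuous_DL1 fM M0.
move=> phi tphi; split; first exact: convolution_continuous.
move=> s; have [sigma [incs [g [lg fg]]]] := aaf s.
(* The subsequence and [g] supplied by the Stepanov property do not depend on [phi]; the limit
   function is the regularisation of [g]. *)
exists sigma; split => //; exists (convolution (distribution_of g) phi) => x; split.
  by apply: (convolution_translate_cvg (r := s \o sigma)) => // y; have [] := fg y.
by apply: (convolution_translate_cvg (r := fun k => - s (sigma k))) => // y;
  have [] := fg y.
Qed.
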